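(* Let $\mathbb{K}$ be a field with $\operatorname{char}\mathbb{K}\neq 2$, let $2\le m\le n$ be integers, and let $H$ be the $m\times n$ generic Hankel matrix over $\mathbb{K}$. Assume that one of the following holds: (1) $m\ge 3$ and $m+n-1\ge 9$; (2) $(m,n)=(3,6)$; (3) $(m,n)=(4,5)$. Then $\operatorname{v}(P_2(H))=1$.
   Context: The $m\times n$ generic Hankel matrix over $\mathbb{K}$ is $H=(h_{ij})$ with $h_{ij}=x_{i+j-1}$ for $1\le i\le m$, $1\le j\le n$, where $x_1,\dots,x_{m+n-1}$ are algebraically independent indeterminates; we work in the standard graded polynomial ring $R=\mathbb{K}[x_1,\dots,x_{m+n-1}]$. $P_2(H)\subseteq R$ denotes the $2\times 2$ permanental ideal of $H$: the ideal generated by all $2\times2$ subpermanents $h_{ik}h_{jl}+h_{il}h_{jk}$ with $1\le i<j\le m$, $1\le k<l\le n$. For a graded ideal $I$ of a standard graded polynomial ring $R=\bigoplus_{d\ge0}R_d$ over a field, the $\operatorname{v}$-number of $I$ is $$\operatorname{v}(I)=\min\{d\mid \text{there exist } f\in R_d \text{ and } \mathfrak{p}\in\operatorname{Ass}(I)\text{ such that } (I:f)=\mathfrak{p}\},$$ where $\operatorname{Ass}(I)$ is the set of associated primes of $R/I$ and $(I:f)=\{g\in R\mid gf\in I\}$. *)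

(* Defs.v *)
From mathcomp Require Import all_boot all_order all_algebra.
From mathcomp Require Export mpoly.

Set Implicit Arguments.
Unset Strict Implicit.
Unset Printing Implicit Defensive.

Import GRing.Theory.
Local Open Scope ring_scope.

(* Ideals are Prop-valued predicates, because those of ring_quotient are
   decidable, whereas colon ideals and associated primes have no evident
   decision procedure. Equality of ideals is pointwise equivalence. *)
Section Ideals.
Variable R : comNzRingType.
Implicit Types (I J P S : R -> Prop) (f g : R).

Definition eq_ideal I J : Prop := forall g, I g <-> J g.

Definition is_ideal I : Prop :=
  [/\ I 0, (forall f g, I f -> I g -> I (f + g)) & (forall f g, I g -> I (f * g))].

Definition is_prime_ideal P : Prop :=
  [/\ is_ideal P, ~ P 1 & (forall f g, P (f * g) -> P f \/ P g)].

(* Finite sums of terms c * s with c in R and s in S. *)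
Definition ideal_gen S : R -> Prop := fun g =>
  exists s : seq (R * R),
    (forall cs, cs \in s -> S cs.2) /\ g = \sum_(cs <- s) cs.1 * cs.2.

Definition colon I f : R -> Prop := fun g => I (g * f).

(* An associated prime of R/I is a prime that is the annihilator of some
   element of R/I; the annihilator of the class of g is colon I g. *)
Definition Ass I P : Prop :=
  is_prime_ideal P /\ exists g, eq_ideal (colon I g) P.

Definition subperm2 m n (A : 'M[R]_(m, n)) (i j : 'I_m) (k l : 'I_n) : R :=
  A i k * A j l + A i l * A j k.

Definition perm_ideal2 m n (A : 'M[R]_(m, n)) : R -> Prop :=
  ideal_gen (fun g => exists (i j : 'I_m) (k l : 'I_n),
    [/\ (i < j)%N, (k < l)%N & g = subperm2 A i j k l]).

End Ideals.

Section VNumber.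
Variables (K : fieldType) (N : nat).

Definition v_witness (I : {mpoly K[N]} -> Prop) (d : nat) : Prop :=
  exists (f : {mpoly K[N]}) (P : {mpoly K[N]} -> Prop),
    [/\ f \is d.-homog, Ass I P & eq_ideal (colon I f) P].

(* v(I) = d. A relation rather than a function, so that no default value is
   needed when the set of degrees is empty. *)
Definition is_v_number (I : {mpoly K[N]} -> Prop) (d : nat) : Prop :=
  v_witness I d /\ forall e, v_witness I e -> (d <= e)%N.

End VNumber.

Section Hankel.
Variables (K : fieldType) (m n : nat).

Lemma hankel_idx_subproof (i : 'I_m) (j : 'I_n) : (i + j < m + n - 1)%N.
Proof.
case: i j => i im [j jn] /=.
by rewrite ltn_subRL add1n -addnS -addSn leq_add.
Qed.

Definition hankel_idx (i : 'I_m) (j : 'I_n) : 'I_(m + n - 1) :=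
  Ordinal (hankel_idx_subproof i j).

(* With indices starting at 0, x_(i+j-1) becomes 'X_(i+j). *)
Definition hankel : 'M[{mpoly K[m + n - 1]}]_(m, n) :=
  \matrix_(i < m, j < n) 'X_(hankel_idx i j).

End Hankel.

(* Main.v *)
Require Import Defs.
From mathcomp Require Import all_boot all_order all_algebra.
From mathcomp Require Import zify ring.

Set Implicit Arguments.
Unset Strict Implicit.
Unset Printing Implicit Defensive.

Import GRing.Theory.
Local Open Scope ring_scope.

(* Write [N = m + n - 1] and number the variables from 0. The generators of [I]
   are the [x_a x_(a+p+q) + x_(a+p) x_(a+q)] with [0 < p < m] and [0 < q < n],
   so all monomials [x_u x_v] of a given index sum [s] are linked. If
   [4 <= s <= 2 N - 6], the three monomials of index sum [s] with the smallest
   [|u - v|] have all pairwise sums in [I]; as 2 is invertible they lie in [I],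
   and then so does every monomial of index sum [s].

   Hence for [N >= 9] every variable multiplies [x_4] into [I], so [I : x_4] is
   the maximal homogeneous ideal. For [N = 8] only [x_0, ..., x_6] do, and no
   nonzero polynomial in [x_7] does, so [I : x_4] is [(x_0, ..., x_6)]. In degree 0,
   [I : c] is [I] or the unit ideal, and [I] is not prime because it contains
   [x_4^2] but not [x_4]. *)

(** * Generated ideals and congruences modulo an ideal *)

Lemma ideal_gen_ideal (R : comNzRingType) (S : R -> Prop) :
  is_ideal (ideal_gen S).
Proof.
split.
- by exists [::]; split=> //; rewrite big_nil.
- move=> f g [s [sS ->]] [s' [s'S ->]]; exists (s ++ s'); split.
    by move=> cs; rewrite mem_cat => /orP[/sS|/s'S].
  by rewrite big_cat.
- move=> f g [s [sS ->]]; exists [seq (f * cs.1, cs.2) | cs <- s]; split.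
    by move=> cs /mapP[cs' /sS ? ->].
  by rewrite big_map mulr_sumr; apply: eq_bigr => cs _; rewrite mulrA.
Qed.

Lemma perm_ideal2_ideal (R : comNzRingType) m n (M : 'M[R]_(m, n)) :
  is_ideal (perm_ideal2 M).
Proof. exact: ideal_gen_ideal. Qed.

Lemma ideal_gen_sub (R : comNzRingType) (S I : R -> Prop) :
  is_ideal I -> (forall g, S g -> I g) -> forall g, ideal_gen S g -> I g.
Proof.
move=> [I0 ID IM] SI g [s [sS ->]].
elim: s sS => [|cs s IHs] sS; first by rewrite big_nil.
rewrite big_cons; apply: ID.
  by apply/IM/SI/sS; rewrite mem_head.
by apply: IHs => cs' ?; apply: sS; rewrite in_cons orbC; apply/orP; left.
Qed.

Lemma dvdXn_ideal (R : comNzRingType) (A : idomainType)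
    (phi : {rmorphism R -> {poly A}}) (e : nat) : is_ideal (fun g => exists q : {poly A}, phi g = q * 'X^e).
Proof.
split.
- by exists 0; rewrite rmorph0 mul0r.
- by move=> f g [p pE] [q qE]; exists (p + q); rewrite rmorphD pE qE mulrDl.
- by move=> f g [q qE]; exists (phi f * q); rewrite rmorphM qE mulrA.
Qed.

(** The polynomials congruent to their image under [rho] are closed under sums and, by the identity
    in [congrM], under products, so constants and variables suffice. *)
Lemma mpoly_congr_ideal (K : fieldType) (N : nat) (I : {mpoly K[N]} -> Prop)
    (rho : {rmorphism {mpoly K[N]} -> {mpoly K[N]}}) :
  is_ideal I ->
  (forall c, rho c%:MP = c%:MP) -> (forall i, I ('X_i - rho 'X_i)) ->
  forall g, I (g - rho g).
Proof.
move=> [I0 ID IM] rhoC rhoX.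
have congrM f g : I (f - rho f) -> I (g - rho g) -> I (f * g - rho (f * g)).
  move=> If Ig; rewrite rmorphM.
  have ->: f * g - rho f * rho g = g * (f - rho f) + rho f * (g - rho g).
    by ring.
  by apply: ID; apply: IM.
have congrX (mm : 'X_{1..N}) : I ('X_[mm] - rho 'X_[mm]).
  rewrite mpolyXE_id.
  elim/big_ind: _ => [|f g|i _]; [by rewrite rmorph1 subrr|exact: congrM|].
  elim: (mm i) => [|k IHk]; first by rewrite expr0 rmorph1 subrr.
  by rewrite exprS; apply: congrM.
elim/mpolyind => [|c mm p _ _ IHp]; first by rewrite rmorph0 subrr.
rewrite rmorphD opprD addrACA -mul_mpolyC; apply: ID => //.
by apply: congrM => //; rewrite rhoC subrr.
Qed.

(** * Colon ideals detected by a homomorphism to polynomials over a domain *)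

Section ColonIdeal.
Variables (K : fieldType) (N : nat) (A : idomainType).
Let R := {mpoly K[N]}.
Variable I : R -> Prop.
Hypothesis idI : is_ideal I.

(** [A] plays the role of the quotient by [colon I f]: [phi] followed by [X = 0] is the projection,
    and [iota] lifts it back. *)
Variables (phi : {rmorphism R -> {poly A}}) (iota : {rmorphism A -> R}).
Variables (f : R) (a : A) (e : nat).
Hypothesis phiI : forall g, I g -> exists q : {poly A}, phi g = q * 'X^(e.+1).
Hypothesis phif : phi f = a *: 'X^e.
Hypothesis a_neq0 : a != 0.

Lemma notin_ideal : ~ I f.
Proof.
move=> /phiI[q]; rewrite phif => /(congr1 (fun p : {poly A} => p`_e)).
rewrite coefZ coefXn eqxx mulr1 coefMXn ltnSn => /eqP.
by rewrite (negPf a_neq0).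
Qed.

Hypothesis iotaC : forall c : K, iota (phi c%:MP).[0] = c%:MP.
Hypothesis iotaX : forall i, I (('X_i - iota (phi 'X_i).[0]) * f).

(* The prime is the kernel of [g |-> (phi g).[0]]. Modulo [X^(e+1)] the image
   of [g * f] is [(phi g).[0] * a * X^e], and conversely [g] is congruent to
   [iota (phi g).[0]] modulo [I : f]. *)
Lemma colon_prime :
  is_prime_ideal (fun g => (phi g).[0] = 0) /\
  eq_ideal (colon I f) (fun g => (phi g).[0] = 0).
Proof.
case: (idI) => I0 ID IM; split.
  split; first split.
  - by rewrite rmorph0 horner0.
  - by move=> g h; rewrite rmorphD hornerD => -> ->; rewrite addr0.
  - by move=> g h; rewrite rmorphM hornerM => ->; rewrite mulr0.
  - by rewrite rmorph1 hornerC; apply/eqP/oner_neq0.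
  - move=> g h; rewrite rmorphM hornerM => /eqP.
    by rewrite mulf_eq0 => /orP[] /eqP; [left|right].
move=> g; split.
  move=> /phiI[q]; rewrite rmorphM phif => /(congr1 (fun p : {poly A} => p`_e)).
  rewrite -scalerAr coefZ !coefMXn ltnn ltnSn subnn => /eqP.
  by rewrite mulf_eq0 (negPf a_neq0) horner_coef0 => /eqP.
have idJ : is_ideal (colon I f).
  rewrite /colon; split; first by rewrite mul0r.
  - by move=> g1 g2; rewrite mulrDl; apply: ID.
  - by move=> g1 g2; rewrite -mulrA; apply: IM.
have rhoC (c : K) : (iota \o (horner_eval 0 \o phi)) c%:MP = c%:MP.
  by rewrite /= /horner_eval iotaC.
have := mpoly_congr_ideal idJ rhoC iotaX g.
by rewrite /colon /= /horner_eval => Ig g0; move: Ig; rewrite g0 rmorph0 subr0.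
Qed.

Lemma v_number1 : f \is 1.-homog -> I (f * f) -> is_v_number I 1%N.
Proof.
move=> f_homog If2; have [prP colonP] := colon_prime; split.
  by exists f, (fun g => (phi g).[0] = 0); split=> //; split=> //; exists f.
case=> // [[g [Q [g_homog [[idQ Q1 Qprime] _] colonQ]]]]; exfalso.
have [I0 ID IM] := idI.
have gE : g = (g@_0)%:MP.
  apply/mpolyP=> mm; rewrite mcoeffC; case: eqVneq => [<-|mm_neq0].
    by rewrite mulr1.
  rewrite mulr0; apply: dhomog_nemf_coeff g_homog _.
  by rewrite mdeg_eq0.
have [g0|g_neq0] := eqVneq g@_0 0.
  by apply/Q1/colonQ; rewrite /colon gE g0 mpolyC0 mulr0.
(* A nonzero constant is a unit, so [colon I g] is [I], and a prime [I] would contain [f] along with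
   [f * f]. *)
have QI h : Q h -> I h.
  move/colonQ; rewrite /colon => /(IM (g@_0)^-1%:MP).
  by rewrite gE mcoeffC eqxx mulr1 mulrCA -mpolyCM mulVf // mulr1.
have Qf2 : Q (f * f) by apply/colonQ; rewrite /colon mulrC; apply: IM.
by case: (Qprime _ _ Qf2) => /QI /notin_ideal.
Qed.

End ColonIdeal.

(* The value is [0] for [k >= N]. *)
Definition hvar (K : fieldType) (N k : nat) : {mpoly K[N]} :=
  oapp (fun i : 'I_N => 'X_i) 0 (insub k).

Lemma hvarE (K : fieldType) N (i : 'I_N) : 'X_i = hvar K N i.
Proof. by rewrite /hvar valK. Qed.

(** * Monomials in the permanental ideal *)

Section HankelIdeal.
Variables (K : fieldType) (m n : nat).
Hypothesis charK : 2%N \notin [pchar K].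
Local Notation N := (m + n - 1)%N.
Local Notation I := (perm_ideal2 (hankel K m n)).
Local Notation x := (hvar K N).

Lemma hankel_subperm2 (i j : 'I_m) (k l : 'I_n) :
  subperm2 (hankel K m n) i j k l =
  x (i + k) * x (j + l) + x (i + l) * x (j + k).
Proof. by rewrite /subperm2 /hankel !mxE !hvarE. Qed.

Lemma hankel_rel (a p q : nat) :
  (0 < p < m)%N -> (0 < q < n)%N -> (a + p + q < N)%N ->
  I (x a * x (a + p + q) + x (a + p) * x (a + q)).
Proof.
move=> pm qn apqN.
(* Row [i] is the largest one that is at most [a] and leaves room for row [i + p]; column [k] takes
   the rest of [a]. *)
pose i := minn a (m - 1 - p); pose k := (a - i)%N.
have im : (i < m)%N by lia.
have jm : (i + p < m)%N by lia.
have kn : (k < n)%N by lia.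
have ln : (k + q < n)%N by lia.
exists [:: (1, subperm2 (hankel K m n) (Ordinal im) (Ordinal jm)
                 (Ordinal kn) (Ordinal ln))]; split.
  move=> cs; rewrite inE => /eqP ->.
  by do 4![eexists]; split; last reflexivity; rewrite /=; lia.
rewrite big_seq1 mul1r hankel_subperm2 /=.
rewrite [X in _ = _ + X]mulrC.
by congr (hvar _ _ _ * hvar _ _ _ + hvar _ _ _ * hvar _ _ _); lia.
Qed.

(** The assumption on the characteristic enters here, through the inverse of 2. *)
Lemma perm_ideal2_halve g : I (g + g) -> I g.
Proof.
have [_ _ IM] := perm_ideal2_ideal (hankel K m n).
have two_neq0 : 2%:R != 0 :> K by apply: contra charK => ?; rewrite inE.
have -> : g + g = (2%:R)%:MP * g by rewrite mpolyC_nat mulr_natl mulr2n.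
by move=> /(IM (2%:R^-1)%:MP); rewrite mulrA -mpolyCM mulVf // mpolyC1 mul1r.
Qed.

Lemma perm_ideal2_pairwise_sums (A B C : {mpoly K[N]}) :
  I (A + B) -> I (A + C) -> I (B + C) -> [/\ I A, I B & I C].
Proof.
have [_ ID IM] := perm_ideal2_ideal (hankel K m n).
have IB f g : I f -> I g -> I (f - g).
  by move=> If Ig; apply: ID => //; rewrite -mulN1r; apply: IM.
move=> AB AC BC.
have IA : I A.
  apply: perm_ideal2_halve.
  have -> : A + A = (A + B) + (A + C) - (B + C) by ring.
  by apply: IB => //; apply: ID.
split=> //.
  have -> : B = (A + B) - A by ring.
  exact: IB.
have -> : C = (A + C) - A by ring.
exact: IB.
Qed.

Hypotheses (m_ge3 : (3 <= m)%N) (n_ge5 : (5 <= n)%N).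

Lemma hankel_mono u v :
  (4 <= u + v)%N -> (u + v + 6 <= N.*2)%N -> (u <= v < N)%N -> I (x u * x v).
Proof.
have [_ ID IM] := perm_ideal2_ideal (hankel K m n).
have [d] := ubnP (v - u)%N; elim: d u v => // d IHd u v uv_d uv4 uv6 uvN.
have rel a p q b c e : (0 < p < m)%N -> (0 < q < n)%N -> (e < N)%N ->
    b = (a + p)%N -> c = (a + q)%N -> e = (a + p + q)%N ->
    I (x a * x e + x b * x c).
  by move=> pm qn eN -> -> e_def; rewrite e_def; apply: hankel_rel; lia.
have [uv5|uv_gt5] := leqP (v - u)%N 5.
  (* By parity the three smallest gaps are 0, 2, 4 or 1, 3, 5; the bounds on [u + v] keep all these
     indices between 0 and [N - 1]. *)
  pose c := (u + v)./2; pose a := (c - 2)%N.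
  have [odd_uv|even_uv] := boolP (odd (u + v)).
    have [] := @perm_ideal2_pairwise_sums (x a * x (a + 5)) (x (a + 1) * x (a + 4))
                 (x (a + 2) * x (a + 3)).
    - by apply: (rel a 1%N 4%N); lia.
    - by apply: (rel a 2%N 3%N); lia.
    - by apply: (rel (a + 1)%N 1%N 2%N); lia.
    have [[-> ->]|[[-> ->]|[-> ->]]] //:
      u = a /\ v = (a + 5)%N \/ u = (a + 1)%N /\ v = (a + 4)%N \/
      u = (a + 2)%N /\ v = (a + 3)%N by lia.
  have [] := @perm_ideal2_pairwise_sums (x a * x (a + 4)) (x (a + 1) * x (a + 3))
               (x (a + 2) * x (a + 2)).
  - by apply: (rel a 1%N 3%N); lia.
  - by apply: (rel a 2%N 2%N); lia.
  - by apply: (rel (a + 1)%N 1%N 1%N); lia.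
  have [[-> ->]|[[-> ->]|[-> ->]]] //:
    u = a /\ v = (a + 4)%N \/ u = (a + 1)%N /\ v = (a + 3)%N \/
    u = (a + 2)%N /\ v = (a + 2)%N by lia.
(* Taking [p] as large as possible forces [q < n]. The companion product has the same index sum and
   the smaller gap [|p - q|]. *)
pose p := minn (m - 1) (v - u - 1); pose q := (v - u - p)%N.
have Irel : I (x u * x v + x (u + p) * x (u + q)).
  by apply: (rel u p q); lia.
have Iin : I (x (u + p) * x (u + q)).
  have [pq|qp] := leqP p q; first by apply: IHd; lia.
  by rewrite mulrC; apply: IHd; lia.
have -> : x u * x v = (x u * x v + x (u + p) * x (u + q)) +
  (- 1) * (x (u + p) * x (u + q)) by ring.
by apply: ID => //; apply: IM.
Qed.

(** The first bound says that the index sum [k + 4] is at most [2 N - 6]. It covers every [k < N]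
    when [N >= 9], and stops at [k = 6] when [N = 8]. *)
Lemma hankel_mono4 k :
  (k + 10 <= N.*2)%N -> (k < N)%N -> (4 < N)%N -> I (x k * x 4).
Proof.
move=> k10 kN N4; have [k4|k4] := leqP k 4; first by apply: hankel_mono; lia.
by rewrite mulrC; apply: hankel_mono; lia.
Qed.

End HankelIdeal.

Section Mmap.
Variables (K : fieldType) (N : nat) (S : comNzRingType).
Variables (c : {rmorphism K -> S}) (h : nat -> S).

Lemma mmap_hvar k :
  (k < N)%N -> mmap c (fun i : 'I_N => h i) (hvar K N k) = h k.
Proof. by move=> kN; rewrite -[k]/(val (Ordinal kN)) -hvarE mmapX mmap1U. Qed.

End Mmap.

(** * The v-number for [N >= 9] and for [N = 8] *)

Section VNumber.
Variables (K : fieldType) (m n : nat).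
Hypothesis charK : 2%N \notin [pchar K].
Hypotheses (m_ge3 : (3 <= m)%N) (n_ge5 : (5 <= n)%N).
Local Notation N := (m + n - 1)%N.
Local Notation I := (perm_ideal2 (hankel K m n)).

Lemma perm_ideal2_dvdXn (A : idomainType)
    (phi : {rmorphism {mpoly K[N]} -> {poly A}}) (h : nat -> {poly A}) (e : nat) :
  (forall k, (k < N)%N -> phi (hvar K N k) = h k) ->
  (forall a p q, (0 < p)%N -> (0 < q)%N -> (a + p + q < N)%N ->
     exists r, h a * h (a + p + q)%N + h (a + p)%N * h (a + q)%N = r * 'X^e) ->
  forall g, I g -> exists r : {poly A}, phi g = r * 'X^e.
Proof.
move=> phiX hE; apply: ideal_gen_sub; first exact: dvdXn_ideal.
move=> _ [i [j [k [l [ij kl ->]]]]].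
rewrite hankel_subperm2 rmorphD !rmorphM !phiX ?hankel_idx_subproof //.
have [r rE] : exists r : {poly A},
    h (i + k)%N * h (j + l)%N + h (j + k)%N * h (i + l)%N = r * 'X^e.
  have := hE (i + k)%N (j - i)%N (l - k)%N.
  have -> : (i + k + (j - i) + (l - k) = j + l)%N by lia.
  have -> : (i + k + (j - i) = j + k)%N by lia.
  have -> : (i + k + (l - k) = i + l)%N by lia.
  by apply; rewrite ?hankel_idx_subproof // subn_gt0.
by exists r; rewrite -rE; congr (_ + _); rewrite mulrC.
Qed.

Lemma v_number_large : (9 <= N)%N -> is_v_number I 1%N.
Proof.
move=> N9; have N4 : (4 < N)%N by lia.
(* Each generator goes to [2 X^2] and [x_4] to [X], so [e = 1]; the constant term is evaluation at
   the origin. *)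
pose phi : {rmorphism {mpoly K[N]} -> {poly K}} := mmap polyC (fun=> 'X).
have phiX k : (k < N)%N -> phi (hvar K N k) = 'X by apply: mmap_hvar.
have IX i : I ('X_i * hvar K N 4).
  by rewrite hvarE; apply: hankel_mono4; have := ltn_ord i; lia.
apply: (@v_number1 _ _ K _ (perm_ideal2_ideal _) phi (@mpolyC N K)
          (hvar K N 4) 1 1).
- apply: (perm_ideal2_dvdXn phiX) => a p q _ _ _.
  by exists 2%:R; rewrite mulr_natl mulr2n expr2.
- by rewrite phiX // expr1 scale1r.
- exact: oner_neq0.
- by move=> c; rewrite /phi /= mmapC hornerC.
- by move=> i; rewrite {2}hvarE phiX // hornerX rmorph0 subr0.
- by rewrite -(hvarE K (Ordinal N4)) dhomogX /= mdeg1.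
- by rewrite -{1}(hvarE K (Ordinal N4)).
Qed.

(* Setting [x_k = t u^(7-k)] up to sign parametrizes, for [k >= 4], the zero
   set of the relations of index sum 11 and 12, and every relation of smaller
   index sum becomes divisible by [u^4], while [x_4] becomes [t u^3]. *)
Lemma v_number_eight : N = 8%N -> is_v_number I 1%N.
Proof.
move=> N8; have N4 : (4 < N)%N by lia.
have N7 : (7 < N)%N by lia.
(* The sign at 5 kills [x_4 x_7 + x_5 x_6] and [x_5 x_7 + x_6^2]. Below, [t] is the inner
   indeterminate and [u] the outer one. *)
pose sgn k : {poly K} := if k == 5%N then -1 else 1.
pose h k : {poly {poly K}} := (sgn k * 'X) *: 'X^(7 - k).
pose phi : {rmorphism {mpoly K[N]} -> {poly {poly K}}} :=
  mmap (polyC \o polyC) (fun i => h i).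
have phiX k : (k < N)%N -> phi (hvar K N k) = h k by apply: mmap_hvar.
(* At [u = 0] only [x_7] survives, with value [t], so [t] lifts to [x_7]. *)
pose iota : {rmorphism {poly K} -> {mpoly K[N]}} :=
  horner_alg (hvar K N 7).
have iotaK c : iota c%:P = c%:MP by rewrite /iota /= horner_algC alg_mpolyC.
have IX k : (k < 7)%N -> I (hvar K N k * hvar K N 4).
  by move=> k7; apply: hankel_mono4; lia.
have hM a b : (a <= 7)%N -> (b <= 7)%N ->
    h a * h b = (sgn a * sgn b * 'X^2) *: 'X^(14 - (a + b)).
  move=> a7 b7; rewrite /h -scalerAl -scalerAr scalerA -exprD mulrACA -expr2.
  by congr (_ *: 'X^_); lia.
apply: (@v_number1 _ _ {poly K} _ (perm_ideal2_ideal _) phi iota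
          (hvar K N 4) 'X 3).
- apply: (perm_ideal2_dvdXn phiX) => a p q p0 q0 apqN.
  rewrite !hM; try lia.
  have -> : (a + p + (a + q) = a + (a + p + q))%N by lia.
  rewrite -scalerDl -mulrDl.
  (* The exponent of [u] is 14 minus the index sum, hence at least 4 up to sum 10; beyond that only
     the two vanishing relations remain. *)
  have [s10|s11] := leqP (a + (a + p + q)) 10%N.
    exists ((sgn a * sgn (a + p + q)%N + sgn (a + p)%N * sgn (a + q)%N) * 'X^2
              *: 'X^(10 - (a + (a + p + q)))).
    by rewrite -scalerAl -exprD; congr (_ *: 'X^_); lia.
  exists 0; rewrite mul0r.
  have : [\/ [/\ a = 4, p = 1 & q = 2], [/\ a = 4, p = 2 & q = 1]
            | [/\ a = 5, p = 1 & q = 1]]%N.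
    have [a4|a5] := leqP a 4; last by apply: Or33; split; lia.
    have [p1|p2] := leqP p 1; [apply: Or31|apply: Or32]; split; lia.
  by case=> [] [-> -> ->]; rewrite /sgn /= !(mul1r, mulr1) ?addrN ?addNr
    mul0r scale0r.
- by rewrite phiX // /h /sgn /= mul1r.
- by rewrite polyX_eq0.
- by move=> c; rewrite /phi /= mmapC /= hornerC; apply: iotaK.
- move=> i; rewrite hvarE phiX // /h hornerZ hornerXn.
  have [i7|i_neq7] := eqVneq (i : nat) 7%N.
    rewrite i7 subnn expr0 mulr1 /sgn /= mul1r /iota /= horner_algX subrr mul0r.
    by case: (perm_ideal2_ideal (hankel K m n)).
  have i_lt7 : (i < 7)%N by have := ltn_ord i; lia.
  by rewrite expr0n subn_eq0 leqNgt i_lt7 mulr0 rmorph0 subr0; apply: IX.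
- by rewrite -(hvarE K (Ordinal N4)) dhomogX /= mdeg1.
- exact: IX.
Qed.

End VNumber.

Theorem theorem5p1 (K : fieldType) (m n : nat)
  (charK : 2%N \notin [pchar K]%R)
  (le2m : (2 <= m)%N) (lemn : (m <= n)%N)
  (hmn : [\/ (3 <= m)%N /\ (9 <= m + n - 1)%N,
             (m, n) = (3%N, 6%N)
           | (m, n) = (4%N, 5%N)]) :
  is_v_number (perm_ideal2 (hankel K m n)) 1%N.
Proof.
case: hmn => [[m3 N9]|[-> ->]|[-> ->]].
(* Here [n >= 5] follows from [m <= n] and [m + n >= 10]. *)
- by apply: v_number_large => //; lia.
- exact: v_number_eight.
- exact: v_number_eight.
Qed.
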